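(* Let $k$ be a field, let $m\geq 1$ be a natural number, $n=2m+1$ and $n'=n-1=2m$. Let $Q$ be the quiver with vertices $1,\dots,n$ whose underlying graph is the path $1-2-\cdots-n$ with the alternating orientation starting and ending with a sink, i.e. with arrows $2i\to 2i-1$ and $2i\to 2i+1$ for $1\leq i\leq m$, so that the sources are the vertices $2,4,\dots,2m$. Let $Q'$ be the full subquiver of $Q$ with the vertex $n$ deleted, i.e. the alternating orientation of the path with $n'$ vertices starting with a sink and ending with a source; its sources are also $2,4,\dots,2m$. Put $$\mathcal{F}_{\mathrm{src}}=\{[a,b]\colon a\leq b\text{ sources}\},\qquad \mathcal{F}_{1-\mathrm{src}}=\{[1,b]\colon b\text{ source}\},$$ $$\mathcal{F}'_{\mathrm{src}}=\mathcal{F}_{\mathrm{src}}\setminus\{[2,n']\},\qquad \mathcal{F}'_{1-\mathrm{src}}=\mathcal{F}_{1-\mathrm{src}}\setminus\{[1,n']\}.$$ Then $$\mathcal{F}'=\mathcal{F}'_{\mathrm{src}}\sqcup\mathcal{F}'_{1-\mathrm{src}}\sqcup\{[1,n'-1]\}\sqcup\{[2,n'-1]\}\sqcup\{[3,n']\}$$ is a maximum antichain of the poset $(\mathcal{P}_{Q'},\leq)$ of cardinality $\frac12(m+1)(m+2)$.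
   Context: A representation $V$ of a quiver $Q$ over $k$ assigns a finite-dimensional $k$-vector space $V_i$ to every vertex $i$ and a $k$-linear map $V_\alpha\colon V_i\to V_j$ to every arrow $\alpha\colon i\to j$. A morphism $\phi\colon V\to W$ is a family of linear maps $\phi_i\colon V_i\to W_i$ with $W_\alpha\circ\phi_i=\phi_j\circ V_\alpha$ for every arrow $\alpha\colon i\to j$; it is a monomorphism if every $\phi_i$ is injective. A vertex is a source if no arrow ends in it, and a sink if no arrow starts in it. For a quiver $Q$ whose underlying graph is the path $1-2-\cdots-N$ and for $1\leq a\leq b\leq N$, let $[a,b]$ denote the representation with $V_i=k$ for $a\leq i\leq b$ and $V_i=0$ otherwise, with $V_\alpha=\mathrm{id}_k$ for every arrow $\alpha$ between vertices in $\{a,\dots,b\}$ and $V_\alpha=0$ for all other arrows. (Every indecomposable representation of $Q$ is isomorphic to one of these.) Let $\mathcal{P}_Q=\{[a,b]\colon 1\leq a\leq b\leq N\}$, ordered by $[a,b]\leq[a',b']$ if and only if there exists a monomorphism $[a,b]\hookrightarrow[a',b']$. An antichain in a poset is a subset of pairwise incomparable elements; it is maximum if no antichain has larger cardinality.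
   Formalization: The formal theorem assumes m ≥ 2 instead of m ≥ 1: for m = 1 the representations [2,n'-1] = [2,1] and [3,n'] = [3,2] do not exist, and the claimed cardinality 3 is impossible since [1,1] < [1,2] in a three-element poset. *)

(* Defs.v *)
From HB Require Import structures.
From mathcomp Require Import all_boot all_order all_algebra.

Set Implicit Arguments.
Unset Strict Implicit.
Unset Printing Implicit Defensive.

Import GRing.Theory.

(* Vertices carry a number, so that a full subquiver keeps the numbering. *)
Record quiver := Quiver {
  vertex : finType;
  arrow : finType;
  arrow_src : arrow -> vertex;
  arrow_tgt : arrow -> vertex;
  label : vertex -> nat }.

Definition is_source (Q : quiver) (x : vertex Q) : bool :=
  [forall al : arrow Q, arrow_tgt al != x].

Definition full_subquiver (Q : quiver) (P : pred (vertex Q)) : quiver :=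
  @Quiver {x : vertex Q | P x}
    {al : arrow Q | P (arrow_src al) && P (arrow_tgt al)}
    (fun al => exist _ (arrow_src (val al)) (proj1 (andP (valP al))))
    (fun al => exist _ (arrow_tgt (val al)) (proj2 (andP (valP al))))
    (fun x => label (val x)).

(* i and j are labels: the arrows are 2l -> 2l - 1 and 2l -> 2l + 1. *)
Definition alt_arrow (i j : nat) : bool :=
  ~~ odd i && ((i == j.+1) || (j == i.+1)).

(* The alternating orientation, with 1 a sink, of the path 1 - 2 - ... - n.
   The ordinal x : 'I_n is the vertex x + 1. *)
Definition alt_quiver (n : nat) : quiver :=
  @Quiver 'I_n {p : 'I_n * 'I_n | alt_arrow p.1.+1 p.2.+1}
    (fun al => (val al).1) (fun al => (val al).2) (fun x => x.+1).

Record representation (k : fieldType) (Q : quiver) := Representation {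
  rep_space : vertex Q -> vectType k;
  rep_map : forall al : arrow Q,
    'Hom(rep_space (arrow_src al), rep_space (arrow_tgt al)) }.

Definition is_morphism (k : fieldType) (Q : quiver) (V W : representation k Q)
    (phi : forall x, 'Hom(rep_space V x, rep_space W x)) : Prop :=
  forall al : arrow Q, (rep_map W al \o phi (arrow_src al) =
                        phi (arrow_tgt al) \o rep_map V al)%VF.

Definition embeds (k : fieldType) (Q : quiver) (V W : representation k Q) :
    Prop :=
  exists phi : forall x, 'Hom(rep_space V x, rep_space W x),
    is_morphism phi /\ (forall x, injective (phi x)).

Definition line_or_zero (k : fieldType) (b : bool) : vectType k :=
  if b then (k^o : vectType k) else ('rV[k]_0 : vectType k).

Definition id_or_zero (k : fieldType) (b c : bool) :
    'Hom(line_or_zero k b, line_or_zero k c) :=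
  match b, c return 'Hom(line_or_zero k b, line_or_zero k c) with
  | true, true => \1%VF
  | _, _ => 0%R
  end.

Definition interval_rep (k : fieldType) (Q : quiver) (a b : nat) :
    representation k Q :=
  @Representation k Q
    (fun x => line_or_zero k (a <= label x <= b))
    (fun al => id_or_zero k (a <= label (arrow_src al) <= b)
                            (a <= label (arrow_tgt al) <= b)).

(* The underlying set of the poset of interval representations: [a,b] is
   encoded by its pair of end vertices. *)
Definition subpath (Q : quiver) : finType :=
  {p : vertex Q * vertex Q | label p.1 <= label p.2}.

Definition lo (Q : quiver) (p : subpath Q) : vertex Q := (val p).1.
Definition hi (Q : quiver) (p : subpath Q) : vertex Q := (val p).2.

Definition interval_le (k : fieldType) (Q : quiver) (p q : subpath Q) : Prop :=
  embeds (interval_rep k Q (label (lo p)) (label (hi p)))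
         (interval_rep k Q (label (lo q)) (label (hi q))).

Definition antichain (T : finType) (le : T -> T -> Prop) (A : {set T}) : Prop :=
  forall p q, p \in A -> q \in A -> p != q -> ~ le p q /\ ~ le q p.

Definition maximum_antichain (T : finType) (le : T -> T -> Prop)
    (A : {set T}) : Prop :=
  antichain le A /\ forall B : {set T}, antichain le B -> #|B| <= #|A|.

(* The singleton {[a,b]}; it is empty if a or b is not the label of a vertex,
   or if b < a. *)
Definition single (Q : quiver) (a b : nat) : {set subpath Q} :=
  [set p | (label (lo p) == a) && (label (hi p) == b)].

Definition F_src (Q : quiver) : {set subpath Q} :=
  [set p | is_source (lo p) && is_source (hi p)].

Definition F_1src (Q : quiver) : {set subpath Q} :=
  [set p | (label (lo p) == 1) && is_source (hi p)].

Definition alt_quiver' (m : nat) : quiver :=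
  @full_subquiver (alt_quiver (2 * m + 1))
    (fun x => label x != 2 * m + 1).

(* Main.v *)
Require Import Defs.
From mathcomp Require Import all_boot all_order all_algebra.
From mathcomp Require Import zify.

(** The order is decided at each end vertex separately. An interval [a,b] embeds
    in [a',b'] exactly when it is contained in it and no arrow leaves
    {a,...,b} inside {a',...,b'}: the left end may move from a to a smaller a'
    exactly when a is a sink, that is odd, and likewise for the right end
    ([embeds_intervalP], [interval_leP]).

    Width is bounded by covering the poset with chains. For i >= 1 the intervals
    [2i+1,2j-1], [2i,2j-1] and [2i,2j], as far as they exist, form a chain,
    indexed by (i,j) with 1 <= i <= j <= m. The intervals [a,2j] with a odd form
    a chain for each j, indexed by (0,j). What remains are the [1,b] with b odd,
    a single chain, indexed by (0,0). So the chains are the pairs i <= j in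
    {0,...,m}, and there are (m+1)(m+2)/2 of them.

    The family F' is an antichain ([family_antichain]) that meets each of these
    chains ([in_family_meets_chains]). Hence it has exactly one element in each
    chain, which gives its cardinality, and no antichain can be larger
    ([maximum_antichain_transversal]). *)

Set Implicit Arguments.
Unset Strict Implicit.
Unset Printing Implicit Defensive.

(** * Monomorphisms between interval representations *)

Lemma eq_hom_from_zero (k : fieldType) (V : vectType k)
    (f g : 'Hom(line_or_zero k false, V)) : f = g.
Proof.
by apply/lfunP => v; rewrite (_ : v = 0%R) ?GRing.linear0 //; apply: thinmx0.
Qed.

Lemma injective_line_support (k : fieldType) (b c : bool)
    (f : 'Hom(line_or_zero k b, line_or_zero k c)) :
  injective f -> b -> c.
Proof.
case: b f; case: c => //= f finj _.
have /finj/eqP : f (1%R : k^o) = f 0%R by rewrite [LHS]thinmx0 [RHS]thinmx0.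
by rewrite GRing.oner_eq0.
Qed.

Lemma id_or_zero_inj (k : fieldType) (b c : bool) :
  (b -> c) -> injective (id_or_zero k b c).
Proof.
case: b; case: c => //= bc u v.
- by rewrite !id_lfunE.
- by have := bc isT.
- by move=> _; rewrite [u]thinmx0 [v]thinmx0.
- by move=> _; rewrite [u]thinmx0 [v]thinmx0.
Qed.

(** A monomorphism forces the support of the source into that of the target, and
    an arrow leaving the support of the source inside that of the target would
    make an injective component vanish: its square reads identity after that
    component on one side and zero on the other. Conversely, under these two
    conditions the identities on the common support form a morphism. *)
Lemma embeds_intervalP (k : fieldType) (Q : quiver) (a b a' b' : nat) :
  embeds (interval_rep k Q a b) (interval_rep k Q a' b') <->
  (forall x : vertex Q, a <= label x <= b -> a' <= label x <= b') /\
  (forall al : arrow Q, a <= label (arrow_src al) <= b ->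
     a' <= label (arrow_tgt al) <= b' -> a <= label (arrow_tgt al) <= b).
Proof.
split=> [[phi [phiM phi_inj]]|[sub closed]].
  have sub (x : vertex Q) : a <= label x <= b -> a' <= label x <= b'.
    exact: injective_line_support (phi_inj x).
  split=> // al; have := phiM al; have := phi_inj (arrow_src al).
  have := sub (arrow_src al).
  move: (phi _) (phi _) => /=.
  case: (a <= label (arrow_src al) <= b) => //.
  case: (a' <= label (arrow_src al) <= b') => [|? ? /(_ isT)] //.
  case: (a <= label (arrow_tgt al) <= b) => //.
  case: (a' <= label (arrow_tgt al) <= b') => //= f' f _ finj.
  rewrite comp_lfun1l comp_lfun0r => f0.
  have /finj/eqP : f (1%R : k^o) = f 0%R by rewrite f0 !lfunE.
  by rewrite GRing.oner_eq0.
exists (fun x => id_or_zero k (a <= label x <= b) (a' <= label x <= b')).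
split=> [al|x]; last by apply: id_or_zero_inj; apply: sub.
have /= := sub (arrow_src al); have := sub (arrow_tgt al); have := closed al.
case: (a <= label (arrow_src al) <= b); last first.
  by move=> *; apply: eq_hom_from_zero.
case: (a' <= label (arrow_src al) <= b') => [|_ _ /(_ isT)] //.
case: (a' <= label (arrow_tgt al) <= b') => /= [/(_ isT isT) ->|_].
  by rewrite comp_lfun1l.
case: (a <= label (arrow_tgt al) <= b) => [/(_ isT)|] //.
by rewrite !comp_lfun0l.
Qed.

(** * Maximum antichains from chain covers *)

(** An antichain takes at most one element from each fiber, so its size is at
    most the number of fibers; meeting every fiber makes [A] largest and equates
    its size with that number. *)
Lemma maximum_antichain_transversal (T I : finType) (le : T -> T -> Prop)
    (f : T -> I) (A : {set T}) :
  (forall p q, f p = f q -> le p q \/ le q p) ->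
  antichain le A -> (forall p, f p \in f @: A) ->
  maximum_antichain le A /\ #|A| = #|f @: A|.
Proof.
move=> fiber antiA surj.
have card_im B : antichain le B -> #|f @: B| = #|B|.
  move=> antiB; apply: card_in_imset => p q pB qB fpq.
  apply/eqP/negPn/negP => /(antiB p q pB qB) [npq nqp].
  by case: (fiber _ _ fpq).
split; last by rewrite card_im.
split=> // B antiB; rewrite -(card_im B antiB) -(card_im A antiA).
by apply: subset_leq_card; apply/subsetP => _ /imsetP [p _ ->].
Qed.

(** * Finite sets *)

Lemma in_bigcup_seq (T : finType) (s : seq {set T}) (x : T) :
  (x \in \bigcup_(A <- s) A) = has (fun A : {set T} => x \in A) s.
Proof.
by elim: s => [|A s IHs]; rewrite ?big_nil ?big_cons !inE // IHs.
Qed.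

Lemma pairwise_disjoint_seq (T : finType) (s : seq {set T}) :
  (forall x, count (fun A : {set T} => x \in A) s <= 1) ->
  pairwise (fun A B : {set T} => [disjoint A & B]) s.
Proof.
elim: s => //= A s IHs once; rewrite IHs ?andbT => [|x]; last first.
  by apply: leq_trans (once x); apply: leq_addl.
apply/allP => B sB; apply/pred0P => x /=; apply/negP => /andP [xA xB].
have := once x; rewrite xA add1n ltnS leqNgt -has_count.
by move/hasPn/(_ B sB); rewrite xB.
Qed.

Lemma card_le_pairs (n : nat) :
  #|[set ij : 'I_n * 'I_n | ij.1 <= ij.2]| = (n * n.+1) %/ 2.
Proof.
rewrite -sum1_card (eq_bigl (fun ij : 'I_n * 'I_n => ij.1 <= ij.2)); last first.
  by move=> ij; rewrite inE.
rewrite -(pair_big_dep xpredT (fun i j : 'I_n => i <= j) (fun _ _ => 1)) /=.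
rewrite (exchange_big_dep xpredT) //=.
rewrite (eq_bigr (fun j : 'I_n => j.+1)) => [|[j lt_jn] _ /=]; last first.
  (* The inner sum counts the i <= j among 0, ..., n-1; cut this range after j. *)
  rewrite -(big_mkord (fun i => i <= j) (fun _ => 1)) sum1_count.
  rewrite /index_iota subn0 -(subnKC lt_jn) iotaD count_cat add0n.
  rewrite (eq_in_count (a2 := predT)) => [|i]; last by rewrite mem_iota /=; lia.
  rewrite count_predT size_iota (eq_in_count (a2 := pred0)) => [|i].
    by rewrite count_pred0 addn0.
  by rewrite mem_iota /=; lia.
elim: n => [|n IHn]; first by rewrite big_ord0.
by rewrite big_ord_recr /= IHn; nia.
Qed.

(** * The combinatorics of end vertices *)

(** The order on intervals, in terms of labels; the odd labels are the sinks. *)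
Definition interval_below (a b a' b' : nat) : bool :=
  [&& a' <= a, b <= b', (a == a') || odd a & (b == b') || odd b].

(** The index 0 in the first component marks the chains whose intervals start at
    a sink and end at a source, and, as (0,0), the chain of the intervals from
    vertex 1 to a sink. *)
Definition chain_index (a b : nat) : nat * nat :=
  if odd a && ~~ odd b then (0, b./2)
  else if a == 1 then (0, 0) else (a./2, uphalf b).

Lemma chain_index_comparable (a b a' b' : nat) :
  1 <= a <= b -> 1 <= a' <= b' -> chain_index a b = chain_index a' b' ->
  interval_below a b a' b' \/ interval_below a' b' a b.
Proof.
rewrite /chain_index /interval_below => ab ab'.
case: ifP => ?; [|case: ifP => ?]; (case: ifP => ?; [|case: ifP => ?]);
  by move/eqP; rewrite xpair_eqE; lia.
Qed.

Lemma chain_index_bounds (m a b : nat) : 1 <= a <= b -> b <= 2 * m ->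
  (chain_index a b).1 <= (chain_index a b).2 <= m.
Proof.
by move=> ab bm; rewrite /chain_index; do 2?[case: ifP => ?] => /=; lia.
Qed.

(** One test for each of the five parts of the family, kept as a list so that
    both the union of the parts and their disjointness can be read off. *)
Definition family_tests (m a b : nat) : seq bool :=
  [:: [&& ~~ ((a == 2) && (b == 2 * m)), ~~ odd a & ~~ odd b];
      [&& ~~ ((a == 1) && (b == 2 * m)), a == 1 & ~~ odd b];
      (a == 1) && (b == 2 * m - 1);
      (a == 2) && (b == 2 * m - 1);
      (a == 3) && (b == 2 * m)].

Definition in_family (m a b : nat) : bool := has id (family_tests m a b).

Lemma family_tests_exclusive (m a b : nat) : count id (family_tests m a b) <= 1.
Proof. by rewrite /family_tests /=; lia. Qed.

Lemma in_family_antichain (m a b a' b' : nat) :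
  1 <= a <= b -> b <= 2 * m -> 1 <= a' <= b' -> b' <= 2 * m ->
  in_family m a b -> in_family m a' b' ->
  interval_below a b a' b' -> a = a' /\ b = b'.
Proof. rewrite /in_family /family_tests /interval_below /=; lia. Qed.

Lemma in_family_meets_chains (m i j : nat) : 2 <= m -> i <= j <= m ->
  exists a b, [/\ 1 <= a <= b, b <= 2 * m, in_family m a b &
                  chain_index a b = (i, j)].
Proof.
move=> m2 ij; pose a := if i == 0 then (if j == m then 3 else 1) else 2 * i.
pose b := if (j == 0) || ((i == 1) && (j == m)) then 2 * m - 1 else 2 * j.
(* The chain (i,j) is represented by [2i,2j], or [1,2j] if i = 0. The intervals
   [1,2m] and [2,2m] do not belong to the family: [3,2m] and [2,2m-1] replace
   them in the chains (0,m) and (1,m), and [1,2m-1] represents (0,0). *)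
exists a, b; rewrite /in_family /chain_index /= /a /b.
do 2?[case: ifP => ?]; case: ifP => ?; split; try lia;
  by do 2?[case: ifP => ?]; apply/eqP; rewrite xpair_eqE; lia.
Qed.

(** * The alternating path and its poset of intervals *)

Section AlternatingPath.
Variable m : nat.
Local Notation Q' := (alt_quiver' m).

Lemma label_bounds (x : vertex Q') : 1 <= label x <= 2 * m.
Proof. by case: x => -[x /= xlt] /= xn; rewrite /label/=; lia. Qed.

Lemma label_vertex_inj : injective (@label Q').
Proof. by move=> x y [] exy; apply/val_inj/val_inj. Qed.

Lemma vertex_of_label (a : nat) :
  1 <= a <= 2 * m -> exists x : vertex Q', label x = a.
Proof.
move=> a_bd; have lt_a : a.-1 < 2 * m + 1 by lia.
have ok : label (Ordinal lt_a : vertex (alt_quiver (2 * m + 1))) != 2 * m + 1.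
  by rewrite /label /=; lia.
by exists (exist _ (Ordinal lt_a) ok); rewrite /label /=; lia.
Qed.

Lemma arrow_alt (al : arrow Q') :
  alt_arrow (label (arrow_src al)) (label (arrow_tgt al)).
Proof. by case: al => -[]. Qed.

Lemma arrow_of_alt (x y : vertex Q') : alt_arrow (label x) (label y) ->
  exists2 al : arrow Q', arrow_src al = x & arrow_tgt al = y.
Proof.
move=> xy.
pose al0 : arrow (alt_quiver (2 * m + 1)) := exist _ (val x, val y) xy.
have ok : (label (arrow_src al0) != 2 * m + 1) &&
          (label (arrow_tgt al0) != 2 * m + 1).
  by apply/andP; split; [exact: (valP x)|exact: (valP y)].
by exists (exist _ al0 ok); apply: val_inj.
Qed.

Lemma is_sourceE (x : vertex Q') : is_source x = ~~ odd (label x).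
Proof.
apply/forallP/idP => [src|even al].
  apply/negP => odd_x; have := label_bounds x => x_bd.
  have [|y lab_y] := @vertex_of_label (label x).+1; first by lia.
  have [|al _ tgt_al] := @arrow_of_alt y x; first by rewrite /alt_arrow; lia.
  by move/eqP: (src al).
apply/negP => /eqP tgt_al; have := arrow_alt al; rewrite tgt_al /alt_arrow.
lia.
Qed.

(** An even end vertex that is not an end of the larger interval has an arrow to
    its neighbour outside the smaller one, and no arrow starts at an odd
    vertex. *)
Lemma interval_leP (k : fieldType) (p q : subpath Q') :
  interval_le k p q <->
  interval_below (label (lo p)) (label (hi p)) (label (lo q)) (label (hi q)).
Proof.
rewrite /interval_below /interval_le embeds_intervalP.
have ab : label (lo p) <= label (hi p) := valP p.
have := label_bounds (lo p); have := label_bounds (hi p).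
have := label_bounds (lo q); have := label_bounds (hi q) => hq lq hp lp.
split=> [[sub closed]|le].
  have := sub (lo p); have := sub (hi p) => subh subl.
  have noL : label (lo q) < label (lo p) -> odd (label (lo p)).
    move=> lt; have [//|even] := boolP (odd (label (lo p))).
    have [|y lab_y] := @vertex_of_label (label (lo p)).-1; first by lia.
    have [|al src tgt] := @arrow_of_alt (lo p) y.
      by rewrite /alt_arrow lab_y; lia.
    by have := closed al; rewrite src tgt lab_y; lia.
  have noR : label (hi p) < label (hi q) -> odd (label (hi p)).
    move=> lt; have [//|even] := boolP (odd (label (hi p))).
    have [|y lab_y] := @vertex_of_label (label (hi p)).+1; first by lia.
    have [|al src tgt] := @arrow_of_alt (hi p) y.
      by rewrite /alt_arrow lab_y; lia.
    by have := closed al; rewrite src tgt lab_y; lia.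
  by lia.
by split=> [x|al]; [|have := arrow_alt al; rewrite /alt_arrow]; lia.
Qed.

Lemma subpath_bounds (p : subpath Q') :
  1 <= label (lo p) <= label (hi p) /\ label (hi p) <= 2 * m.
Proof.
have ab : label (lo p) <= label (hi p) := valP p.
by have := label_bounds (lo p); have := label_bounds (hi p); lia.
Qed.

Lemma subpath_of_labels (a b : nat) : 1 <= a <= b -> b <= 2 * m ->
  exists p : subpath Q', label (lo p) = a /\ label (hi p) = b.
Proof.
move=> ab bm.
have [|x lab_x] := @vertex_of_label a; first by lia.
have [|y lab_y] := @vertex_of_label b; first by lia.
have xy : label x <= label y by rewrite lab_x lab_y; lia.
by exists (exist _ (x, y) xy).
Qed.

Lemma subpath_label_inj (p q : subpath Q') :
  label (lo p) = label (lo q) -> label (hi p) = label (hi q) -> p = q.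
Proof.
move=> /label_vertex_inj eq_lo /label_vertex_inj eq_hi; apply: val_inj.
rewrite [val p]surjective_pairing [val q]surjective_pairing.
by congr (_, _); [exact: eq_lo|exact: eq_hi].
Qed.

Definition family : {set subpath Q'} :=
  [set p | in_family m (label (lo p)) (label (hi p))].

Definition chain_of (p : subpath Q') : 'I_m.+1 * 'I_m.+1 :=
  let ij := chain_index (label (lo p)) (label (hi p)) in
  (inord ij.1, inord ij.2).

Lemma chain_of_val (p : subpath Q') :
  ((chain_of p).1 : nat, (chain_of p).2 : nat) =
  chain_index (label (lo p)) (label (hi p)).
Proof.
have [ab bm] := subpath_bounds p; have := chain_index_bounds ab bm.
rewrite /chain_of; case: (chain_index _ _) => i j /= ij.
by rewrite !inordK //; lia.
Qed.

Lemma chain_of_comparable (k : fieldType) (p q : subpath Q') :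
  chain_of p = chain_of q -> interval_le k p q \/ interval_le k q p.
Proof.
have [abp _] := subpath_bounds p; have [abq _] := subpath_bounds q.
move=> pq; have := chain_of_val q; rewrite -pq chain_of_val.
by case/(chain_index_comparable abp abq) => le; [left|right]; apply/interval_leP.
Qed.

Lemma family_antichain (k : fieldType) :
  antichain (@interval_le k Q') family.
Proof.
have anti (p q : subpath Q') :
    p \in family -> q \in family -> interval_le k p q -> p = q.
  rewrite !inE => pF qF /interval_leP le.
  have [abp bp] := subpath_bounds p; have [abq bq] := subpath_bounds q.
  have [? ?] := in_family_antichain abp bp abq bq pF qF le.
  exact: subpath_label_inj.
move=> p q pF qF /eqP npq; split=> [/(anti _ _ pF qF)|/(anti _ _ qF pF)] //.
by move/esym.
Qed.

(** The image is the full set of chain indices, so it gives at once that the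
    family meets every chain and how many chains there are. *)
Lemma chain_of_family : 2 <= m ->
  chain_of @: family = [set ij : 'I_m.+1 * 'I_m.+1 | ij.1 <= ij.2].
Proof.
move=> m2; apply/setP => -[i j]; rewrite inE /=; apply/imsetP/idP.
  case=> p _ eq_ij; have := chain_of_val p; rewrite -eq_ij /=.
  have [ab bm] := subpath_bounds p; have := chain_index_bounds ab bm.
  by move=> + ch; rewrite -ch /= => /andP[].
move=> ij; have ijm : i <= j <= m by rewrite ij -ltnS ltn_ord.
have [a [b [ab bm abF ch]]] := in_family_meets_chains m2 ijm.
have [p [lab_lo lab_hi]] := subpath_of_labels ab bm.
exists p; first by rewrite inE lab_lo lab_hi.
by rewrite /chain_of lab_lo lab_hi ch /= !inord_val.
Qed.

Lemma family_maximum (k : fieldType) : 2 <= m ->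
  maximum_antichain (@interval_le k Q') family /\
  #|family| = (m.+1 * m.+2) %/ 2.
Proof.
move=> m2; rewrite -card_le_pairs -chain_of_family //.
apply: maximum_antichain_transversal.
- exact: chain_of_comparable.
- exact: family_antichain.
move=> p; rewrite chain_of_family // inE.
have [ab bm] := subpath_bounds p; have := chain_index_bounds ab bm.
by rewrite -chain_of_val => /andP[].
Qed.

Lemma in_F_src (p : subpath Q') :
  (p \in F_src Q') = ~~ odd (label (lo p)) && ~~ odd (label (hi p)).
Proof. by rewrite in_set !is_sourceE. Qed.

Lemma in_F_1src (p : subpath Q') :
  (p \in F_1src Q') = (label (lo p) == 1) && ~~ odd (label (hi p)).
Proof. by rewrite in_set is_sourceE. Qed.

Lemma in_single (p : subpath Q') (a b : nat) :
  (p \in single Q' a b) = (label (lo p) == a) && (label (hi p) == b).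
Proof. by rewrite in_set. Qed.

Lemma part_membership (p : subpath Q') :
  [seq p \in A | A : {set subpath Q'} <-
     [:: F_src Q' :\: single Q' 2 (2 * m); F_1src Q' :\: single Q' 1 (2 * m);
         single Q' 1 (2 * m - 1); single Q' 2 (2 * m - 1);
         single Q' 3 (2 * m)]] =
  family_tests m (label (lo p)) (label (hi p)).
Proof.
rewrite /map /family_tests; congr [:: _; _; _; _; _]; last 3 first.
- exact: in_single.
- exact: in_single.
- exact: in_single.
- by rewrite in_setD in_single in_F_src.
- by rewrite in_setD in_single in_F_1src.
Qed.

End AlternatingPath.

(** * The maximum antichain *)

Theorem corollary2p9 (k : fieldType) (m : nat) (hm : 2 <= m) :
  let n' := 2 * m in
  let Q' := alt_quiver' m in
  let F'_src := F_src Q' :\: single Q' 2 n' in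
  let F'_1src := F_1src Q' :\: single Q' 1 n' in
  let parts := [:: F'_src; F'_1src; single Q' 1 (n' - 1);
                   single Q' 2 (n' - 1); single Q' 3 n'] in
  let F' := \bigcup_(A <- parts) A in
  [/\ pairwise (fun A B : {set subpath Q'} => [disjoint A & B]) parts,
      maximum_antichain (@interval_le k Q') F'
    & #|F'| = ((m + 1) * (m + 2)) %/ 2].
Proof.
cbv zeta; set parts := [:: _; _; _; _; _]; set F' := \bigcup_(A <- parts) A.
have F'E : F' = family m.
  by apply/setP => p; rewrite in_bigcup_seq in_set /in_family
    -part_membership has_map.
have [max_family card_family] := family_maximum k hm.
rewrite F'E; split=> //; last by rewrite addn1 addn2.
apply: pairwise_disjoint_seq => p.
apply: leq_trans (family_tests_exclusive m (label (lo p)) (label (hi p))).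
by rewrite -part_membership count_map.
Qed.
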